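(* Let $a,b,c\ge1$ be integers. If $a+b+c-1$ is prime and $c>\frac{2ab-2}{3}-a-b+2$, then the cardinality of every orbit of $\mathrm{Row}$ on $J(\mathbf a\times\mathbf b\times\mathbf c)$ is a multiple of $a+b+c-1$.
   Context: $\mathbf a\times\mathbf b\times\mathbf c$ is the set of integer triples $(x_1,x_2,x_3)$ with $0\le x_1\le a-1$, $0\le x_2\le b-1$, $0\le x_3\le c-1$, ordered componentwise. $J(P)$ is the set of order ideals (downward closed subsets) of a finite poset $P$; $J(\mathbf a\times\mathbf b\times\mathbf c)$ is the set of plane partitions in an $a\times b\times c$ box. Rowmotion $\mathrm{Row}:J(P)\to J(P)$ is the bijection sending $I$ to the order ideal whose maximal elements are exactly the minimal elements of $P\setminus I$. *)

(* Defs.v *)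
From mathcomp Require Import all_boot all_order all_algebra.

Set Implicit Arguments.
Unset Strict Implicit.
Unset Printing Implicit Defensive.

Import Order.TTheory GRing.Theory Num.Theory.

Local Open Scope order_scope.

Section Rowmotion.

Context {d : Order.disp_t} {P : finPOrderType d}.
Implicit Types (A I : {set P}) (x y : P).

Definition is_ideal I : bool :=
  [forall x, forall y, (x <= y) ==> (y \in I) ==> (x \in I)].

Definition minimal A x : bool := (x \in A) && [forall y in A, ~~ (y < x)].
Definition maximal A x : bool := (x \in A) && [forall y in A, ~~ (x < y)].

Definition row_set I : {set P} :=
  [set x | [exists y, minimal (~: I) y && (x <= y)]].

Lemma row_set_ideal I : is_ideal (row_set I).
Proof.
apply/forallP=> x; apply/forallP=> y; apply/implyP=> xy; apply/implyP.
rewrite !inE => /existsP[z /andP[mz yz]]; apply/existsP; exists z.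
by rewrite mz (le_trans xy yz).
Qed.

Lemma maximal_row_set I x : maximal (row_set I) x = minimal (~: I) x.
Proof.
have inR y : minimal (~: I) y -> y \in row_set I.
  by move=> my; rewrite inE; apply/existsP; exists y; rewrite my lexx.
apply/andP/idP=> [[]|mx].
  rewrite inE => /existsP[y /andP[my xy]] /forallP/(_ y).
  by rewrite inR //= lt_neqAle xy andbT negbK => /eqP ->.
split; first exact: inR.
apply/forallP=> y; apply/implyP; rewrite inE => /existsP[z /andP[mz yz]].
apply/negP=> xy; case/andP: mz => _ /forallP/(_ x).
by case/andP: mx => -> _ /=; rewrite (lt_le_trans xy yz).
Qed.

Lemma minimal_below A x : x \in A -> exists2 y, minimal A y & y <= x.
Proof.
move=> Ax; pose Q := [pred y | (y \in A) && (y <= x)].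
have Qx : Q x by rewrite /= Ax lexx.
case: (@arg_minnP _ x Q (fun y => #|[set z | z <= y]|) Qx) => y /andP[Ay yx] ymin.
exists y => //; rewrite /minimal Ay; apply/forallP=> z; apply/implyP=> Az.
apply/negP=> zy; have := ymin z; rewrite /= Az (le_trans (ltW zy) yx) => /(_ isT).
rewrite leqNgt => /negP; apply; apply: proper_card; apply/properP; split.
  by apply/subsetP=> t; rewrite !inE => tz; apply: le_trans tz (ltW zy).
by exists y; rewrite !inE ?lexx // lt_geF.
Qed.

Definition ideals := {I : {set P} | is_ideal I}.

Definition Row (I : ideals) : ideals := Sub (row_set (val I)) (row_set_ideal _).

Lemma Row_inj : injective Row.
Proof.
move=> I J /(congr1 val) /= RIJ; apply/val_inj/setP=> x; apply: negb_inj.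
suff up (K : ideals) : (x \notin val K) =
    [exists y, maximal (row_set (val K)) y && (y <= x)] by rewrite !up RIJ.
apply/idP/existsP=> [xK|[y /andP[]]].
  have [|y my yx] := @minimal_below (~: val K) x; first by rewrite inE.
  by exists y; rewrite maximal_row_set my.
rewrite maximal_row_set => /andP[yK _] yx; apply/negP=> xK.
have /forallP/(_ y)/forallP/(_ x) := valP K.
by rewrite yx xK /=; move: yK; rewrite inE => /negPf ->.
Qed.

Lemma Row_bij : bijective Row.
Proof. exact: injF_bij Row_inj. Qed.

End Rowmotion.

Arguments ideals {d} P.

(* 'I_n is {0, ..., n-1}, and *p carries the componentwise order. *)
Definition box (a b c : nat) := ('I_a *p 'I_b *p 'I_c)%type.

Lemma le_box a b c (x y : box a b c) :
  (x <= y) = [&& (x.1.1 <= y.1.1)%N, (x.1.2 <= y.1.2)%N & (x.2 <= y.2)%N].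
Proof. by rewrite andbA. Qed.

(* Main.v *)
Require Import Defs.
From mathcomp Require Import all_boot all_order all_algebra.
From mathcomp Require Import zify.

Set Implicit Arguments.
Unset Strict Implicit.
Unset Printing Implicit Defensive.

(** Write q = a + b + c - 1, let I_n be the n-th rowmotion iterate of I, and
let H_n(x, y) be the height of the column of I_n over (x, y). The argument
shows that the heights over the corner (0, b - 1) repeat with period q
(corner_periodic), and that these heights cannot stay constant
(corner_not_constant). If q were coprime to the length N of the orbit of I,
a Bezout relation u q = v N + 1 would turn the two periods q and N into
period 1 for the corner, a contradiction. As q is prime, it divides N.

Periodicity of the corner. Reading the column over (x, y) at the delayed time
i + x + y turns rowmotion into K-theoretic promotion: the array
T_i(x, y) = x + y + 1 + c - H_(i+x+y)(x, y) is strictly increasing along rows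
and columns, takes its values between 1 and q, and T_(i+1) is the K-promotion
of T_i. Let lambda_(i,m) be the set of (x, y) with T_i(x, y) <= m - i. These
shapes are Young diagrams, decreasing in i and increasing in m, empty for
m = i and equal to the full a x b rectangle for m = i + q. On every unit square
of the (i, m)-plane they satisfy the local rule of K-theoretic growth
diagrams, which is a restatement of the toggle rule of rowmotion
(slice_growth).

Fix j <= q. For each m between j and q, the sets
lambda_(j,m), ..., lambda_(1,m), lambda_(0,m), each contained in the next, form
a skew increasing tableau, and passing from m to m + 1 is a K-theoretic jeu de taquin slide.
Slides preserve the length of the longest increasing subsequence of the
reading word; only the case of length b, one box in each column, is needed,
and it is proved by hand (chain_slide for one direction; the other follows by
rotating everything by a half turn). At m = j such a subsequence exists if and
only if the first row of lambda_(0,j) is full, and at m = q if and only if the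
last row of lambda_(j,q) is empty. Thus

  (0, b-1) is in lambda_(0,j)  iff  (a-1, 0) is not in lambda_(j,q)

(corner_reflection). Combining this with its transpose gives
(0, b-1) in lambda_(0,j) iff (0, b-1) in lambda_(q,q+j), for all j, which is
the period q of the corner heights.

A constant corner is impossible. Suppose that the height h over (0, b - 1)
never changes. If h = c, then the top box of this column lies in every
iterate, and a box that survives a step has a box covering it in the new
ideal; so the top box over (1, b - 1) is always present too, and so on down to
(a - 1, b - 1), where no covering box exists. If h < c, the lowest absent
box of the column is never added, so some box that it covers is always missing,
and this must be the one at the same height over (0, b - 2); continuing, one
reaches (0, 0), where nothing can be missing. *)

(** * Layered tableaux and chains *)

Definition cov (u v : nat * nat) : bool :=
  (v == (u.1.+1, u.2)) || (v == (u.1, u.2.+1)).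

Definition inbox (a b : nat) (u : nat * nat) : bool := (u.1 < a) && (u.2 < b).

Lemma covP u v : reflect (v = (u.1.+1, u.2) \/ v = (u.1, u.2.+1)) (cov u v).
Proof. by apply: (iffP orP) => -[/eqP|/eqP]; auto. Qed.

Definition shapes := nat -> nat * nat -> bool.

(** A skew increasing tableau on the a x b rectangle, as the decreasing family
of shapes al 0, ..., al j: the entry of a box is the last i with al i
containing it, so entries decrease to the right and downwards. The rook
condition says that no two boxes of al i outside al i.+1 are adjacent, i.e.
that this decrease is strict. *)
Record layered (a b j : nat) (al : shapes) : Prop := Layered {
  layered_ideal i u v : i <= j -> cov u v -> inbox a b v -> al i v -> al i u;
  layered_mono i u : i < j -> inbox a b u -> al i.+1 u -> al i u;
  layered_rook i u v :
    i < j -> cov u v -> inbox a b v -> al i v -> al i.+1 u }.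

(** Two consecutive columns of a K-theoretic growth diagram. In the square with
corners al i.+1 (smallest), al i, nu i.+1, nu i (largest), the last two fields
say that a box of nu i outside al i.+1 which can be added to al i.+1 and removed
from nu i lies in exactly one of al i and nu i.+1: strip_up forbids both, and
strip_down forbids neither. The half turn of the rectangle exchanges
the two fields. *)
Record strip (a b j : nat) (al nu : shapes) : Prop := Strip {
  strip_inner : layered a b j al;
  strip_outer : layered a b j nu;
  strip_sub i u : i <= j -> inbox a b u -> al i u -> nu i u;
  strip_rook i u v : i <= j -> cov u v -> inbox a b v -> nu i v -> al i u;
  strip_up i u : i < j -> inbox a b u ->
    al i u -> nu i.+1 u -> ~~ al i.+1 u ->
    exists v, [/\ cov u v, inbox a b v & nu i v];
  strip_down i u : i < j -> inbox a b u ->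
    nu i u -> ~~ al i u -> ~~ nu i.+1 u ->
    exists2 v, cov v u & ~~ al i.+1 v }.

(** The boxes (r p, p), with entries d p, form an increasing subsequence of length
b of the row reading word: moving to the right they move weakly
upwards, and the entries go strictly down because al is indexed
decreasingly. *)
Definition chain (a b j : nat) (al : shapes) : Prop :=
  exists r d : nat -> nat, forall p, p < b ->
    [/\ r p < a, d p < j, al (d p) (r p, p), ~~ al (d p).+1 (r p, p)
      & p.+1 < b -> r p.+1 <= r p /\ d p.+1 < d p].

(** The entry of the box u in the tableau al; it is meaningful when al 0
contains u and al j does not. *)
Definition depth (j : nat) (al : shapes) (u : nat * nat) : nat :=
  find (fun i => ~~ al i.+1 u) (iota 0 j).

Section Layered.

Variables (a b j : nat) (al : shapes).
Hypothesis L : layered a b j al.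

Lemma layered_le i k u : inbox a b u -> i <= k -> k <= j -> al k u -> al i u.
Proof.
move=> bu; elim: k => [|k IH]; first by rewrite leqn0 => /eqP->.
rewrite leq_eqVlt => /orP[/eqP-> //|]; rewrite ltnS => ik kj ak.
by apply: IH => //; [exact: ltnW | exact: (layered_mono L)].
Qed.

Lemma layered_west i x y y' :
  i <= j -> x < a -> y' < b -> y <= y' -> al i (x, y') -> al i (x, y).
Proof.
move=> ij xa; elim: y' => [|y' IH] yb; first by rewrite leqn0 => /eqP->.
rewrite leq_eqVlt => /orP[/eqP-> //|]; rewrite ltnS => yy' ay.
apply: IH => //; first exact: ltnW.
by apply: (layered_ideal L ij _ _ ay); [apply/covP; right | rewrite /inbox xa].
Qed.

Lemma layered_north i x x' y :
  i <= j -> x' < a -> y < b -> x <= x' -> al i (x', y) -> al i (x, y).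
Proof.
move=> ij xa yb; elim: x' xa => [|x' IH] xa; first by rewrite leqn0 => /eqP->.
rewrite leq_eqVlt => /orP[/eqP-> //|]; rewrite ltnS => xx' ax.
apply: IH => //; first exact: ltnW.
by apply: (layered_ideal L ij _ _ ax); [apply/covP; left | rewrite /inbox /= xa].
Qed.

Lemma depthP u i0 i1 : inbox a b u ->
    i0 <= j -> al i0 u -> i1 < j -> ~~ al i1.+1 u ->
  let e := depth j al u in
  [/\ e < j, al e u, ~~ al e.+1 u & i0 <= e <= i1].
Proof.
move=> bu i0j a0 i1j a1 e.
have hase : has (fun i => ~~ al i.+1 u) (iota 0 j).
  by apply/hasP; exists i1 => //; rewrite mem_iota.
have ej : e < j by move: hase; rewrite has_find size_iota.
have ae1 : ~~ al e.+1 u.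
  by have := nth_find 0 hase; rewrite -/(depth j al u) nth_iota ?add0n.
have before i : i < e -> al i.+1 u.
  move=> ie; have := @before_find _ 0 (fun i => ~~ al i.+1 u) (iota 0 j) _ ie.
  by rewrite nth_iota ?add0n; [move/negbFE | apply: ltn_trans ej].
have i0e : i0 <= e.
  by rewrite leqNgt; apply: contra ae1 => lt; apply: layered_le a0.
have ei1 : e <= i1.
  by rewrite leqNgt; apply: contra a1 => /before.
split=> //; last by rewrite i0e.
case E: e before => [|e'] before; last exact: before.
exact: layered_le a0.
Qed.

Lemma row_chain r : 0 < b -> r < a ->
  al 0 (r, b.-1) -> ~~ al j (r, 0) -> chain a b j al.
Proof.
move=> b0 ra afirst alast.
have bx p : p < b -> inbox a b (r, p) by move=> pb; rewrite /inbox ra.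
have j0 : 0 < j.
  rewrite lt0n; apply: contra alast => /eqP->.
  by apply: layered_west afirst; lia.
have D p (pb : p < b) : let e := depth j al (r, p) in
    [/\ e < j, al e (r, p) & ~~ al e.+1 (r, p)].
  have [|||||? ? ? _] := @depthP (r, p) 0 j.-1; try by [|lia|exact: bx].
  - by apply: layered_west afirst; lia.
  - by rewrite prednK //; apply: contra alast; apply: layered_west.
exists (fun=> r), (fun p => depth j al (r, p)) => p pb.
have [ej e1 e2] := D _ pb; split=> // pb1; split=> //.
have [ej' e1' _] := D _ pb1.
rewrite ltnNge; apply: contra e2 => le.
apply: (@layered_le _ (depth j al (r, p.+1)).+1) => //; first exact: bx.
by apply: (layered_rook L ej' _ (bx _ pb1) e1'); apply/covP; right.
Qed.

Lemma chain_start : 0 < b -> chain a b j al -> ~~ al j (a.-1, 0).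
Proof.
move=> b0 [r [d C]]; have [ra dj _ n1 _] := C _ b0.
have a1 : a.-1 < a by lia.
apply: contra n1 => aj; apply: (@layered_le _ j) => //; first by rewrite /inbox ra.
by apply: layered_north aj => //; lia.
Qed.

Lemma chain_end : 0 < b -> chain a b j al -> al 0 (0, b.-1).
Proof.
move=> b0 [r [d C]]; have b1 : b.-1 < b by lia.
have [ra dj n1 _ _] := C _ b1.
apply: (@layered_north _ _ (r b.-1)) => //.
by apply: layered_le n1 => //; [rewrite /inbox ra | exact: ltnW].
Qed.

End Layered.

(** * Chains survive slides *)

Section Slide.

Variables (a b j : nat) (al nu : shapes).
Hypothesis S : strip a b j al nu.

(** A chain of nu is turned into a chain of al, where some of its boxes are
moved up by one row and the others stay. A box of the chain that loses its entry
d p passes it to its upper or to its left neighbour. In the second case the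
left neighbour must be the previous box of the chain, and it has lost its entry
as well; so, going left along the row, one finds a box l whose entry went up.
From l on, the rest of the row of the chain is moved up to the row above. There
the entries of al still decrease strictly by the rook condition, and at column p
they lie between d p and d l, so they fit with the remaining boxes of the
chain. *)
Lemma chain_slide : chain a b j nu -> chain a b j al.
Proof.
case=> r [d C]; have Al := strip_inner S; have Nu := strip_outer S.
(* Whether the box of column p is to be moved up; r l = r p keeps l and p in the
   same row, hence also all the columns in between. *)
pose sg p := has (fun l =>
  [&& r l == r p, 0 < r l & ~~ al (d l).+1 ((r l).-1, l)]) (iota 0 p.+1).
have sgP p : reflect (exists l, [/\ l <= p, r l = r p, 0 < r l
    & ~~ al (d l).+1 ((r l).-1, l)]) (sg p).
  apply: (iffP hasP) => [[l]|[l [lp rl r0 nl]]].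
    by rewrite mem_iota /= add0n ltnS => lp /and3P[/eqP rl r0 nl]; exists l.
  by exists l; rewrite ?mem_iota //= rl eqxx -rl r0.
(* Boxes that need to move are moved, by induction along the row. *)
have moved p : p < b -> ~~ al (d p) (r p, p) -> sg p.
  elim: p => [|p IH] pb nal.
    have [ra dj n1 n2 _] := C _ pb.
    have bu : inbox a b (r 0, 0) by rewrite /inbox ra.
    have [v /covP[] E nv] := strip_down S dj bu n1 nal n2; last by case: E.
    apply/sgP; exists 0; case: E => E1 E2; rewrite E1 /=; split=> //.
    by case: v E1 E2 nv => ? ? /= _ ->.
  have [ra dj n1 n2 _] := C _ pb.
  have pb' := ltnW pb.
  have [ra' dj' n1' n2' /(_ pb)[rle dlt]] := C _ pb'.
  have bu : inbox a b (r p.+1, p.+1) by rewrite /inbox ra.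
  have bu' : inbox a b (r p, p) by rewrite /inbox ra'.
  have [v /covP[] E nv] := strip_down S dj bu n1 nal n2.
    apply/sgP; exists p.+1; case: E => E1 E2; rewrite E1 /=; split=> //.
    by case: v E1 E2 nv => ? ? /= _ ->.
  have {}nv : ~~ al (d p.+1).+1 (r p.+1, p).
    by case: v E nv => x y /= [-> ->].
  (* A box of the chain in column p strictly below would force, by the ideal
     and rook conditions, the left neighbour to be in al (d p.+1).+1. *)
  have req : r p = r p.+1.
    apply/eqP; rewrite eqn_leq rle andbT leqNgt; apply: contra nv => rlt.
    have m : nu (d p.+1).+1 (r p, p) by apply: (layered_le Nu) n1' => //; exact: ltnW.
    have := layered_north Nu dj ra' pb' rlt m.
    apply: (strip_rook S dj); first by apply/covP; left.
    by rewrite /inbox /= pb' (leq_ltn_trans rlt).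
  have /sgP[l [lp rl r0 nl]] : sg p.
    apply: IH => //; apply: contra nv; rewrite -req.
    by apply: (layered_le Al) => //; exact: ltnW.
  by apply/sgP; exists l; rewrite -req; split=> //; exact: leqW.
have rmono l p : p < b -> l <= p -> r p <= r l.
  elim: p => [|p IH] pb; first by rewrite leqn0 => /eqP->.
  rewrite leq_eqVlt => /orP[/eqP-> //|]; rewrite ltnS => lp.
  have [_ _ _ _ /(_ pb)[rle _]] := C _ (ltnW pb).
  by apply: leq_trans rle _; apply: IH => //; exact: ltnW.
pose X p := if sg p then (r p).-1 else r p.
pose d' p := if sg p then depth j al (X p, p) else d p.
(* The new entry of a moved box, bounded by the old ones at p and l. *)
have sgD p l : p < b -> l <= p -> r l = r p -> 0 < r l ->
    ~~ al (d l).+1 ((r l).-1, l) ->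
    let e := depth j al ((r p).-1, p) in
    [/\ e < j, al e ((r p).-1, p), ~~ al e.+1 ((r p).-1, p) & d p <= e <= d l].
  move=> pb lp rl r0 nl; have [ra dj n1 n2 _] := C _ pb.
  have [_ djl _ _ _] := C _ (leq_ltn_trans lp pb).
  have bu : inbox a b (r p, p) by rewrite /inbox ra.
  have ra1 : (r p).-1 < a by lia.
  have bu' : inbox a b ((r p).-1, p) by rewrite /inbox ra1.
  apply: (depthP Al) => //.
  - exact: ltnW.
  - apply: (strip_rook S (ltnW dj) _ bu n1); apply/covP; left => /=.
    by rewrite prednK // -rl.
  - by apply: contra nl; rewrite rl; apply: (layered_west Al) => //.
have F p : p < b -> [/\ X p < a, d' p < j, al (d' p) (X p, p),
    ~~ al (d' p).+1 (X p, p) & d p <= d' p].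
  move=> pb; have [ra dj n1 n2 _] := C _ pb.
  have bu : inbox a b (r p, p) by rewrite /inbox ra.
  rewrite /d' /X; case: ifP => [/sgP[l [lp rl r0 nl]]|/negP nsg].
    have [-> -> -> /andP[-> _]] := sgD p l pb lp rl r0 nl; split=> //; lia.
  split=> //; first by apply/negPn; apply: contra_notN nsg; exact: moved.
  by apply: contra n2; exact: (strip_sub S).
exists X, d' => p pb; have [Xa dj a1 a2 dd] := F _ pb; split=> // pb1.
have [_ _ _ _ /(_ pb1)[rle dlt]] := C _ pb.
have [Xa1 dj1 b1 b2 _] := F _ pb1.
have [s1|ns1] := boolP (sg p.+1); last first.
  have E1 : d' p.+1 = d p.+1 by rewrite /d' (negPf ns1).
  have E2 : X p.+1 = r p.+1 by rewrite /X (negPf ns1).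
  rewrite E1 E2; split; last exact: leq_trans dd.
  rewrite /X; case: ifP => // /sgP[l [lp rl r0 nl]].
  have : r p.+1 != r p.
    apply: contra ns1 => /eqP E; apply/sgP; exists l.
    by rewrite E; split=> //; exact: leqW.
  lia.
have E2 : X p.+1 = (r p.+1).-1 by rewrite /X s1.
have /sgP[l [lp rl r0 nl]] := s1.
move: lp; rewrite leq_eqVlt => /orP[/eqP E|lp].
  (* The row starts at p.+1, so both bounds of the new entry coincide. *)
  subst l; have [_ _ _ De] := sgD p.+1 p.+1 pb1 (leqnn _) rl r0 nl.
  have E1 : d' p.+1 = d p.+1.
    by rewrite /d' s1 E2; apply/eqP; rewrite eqn_leq andbC.
  rewrite E1 E2; split; last exact: leq_trans dd.
  by rewrite /X; case: ifP => _; lia.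
(* Both boxes are moved within one row: the rook condition of al applies. *)
have rE : r p = r p.+1 by have := rmono l p pb lp; lia.
have s : sg p by apply/sgP; exists l; rewrite rE.
have E3 : X p = X p.+1 by rewrite /X s s1 rE.
split; first by rewrite E3.
rewrite ltnNge; apply: contra a2 => le.
have bu : inbox a b (X p, p) by rewrite /inbox /= Xa.
apply: (@layered_le _ _ _ _ Al _ (d' p.+1).+1) => //.
apply: (layered_rook Al dj1 _ _ b1); first by apply/covP; right; rewrite E3.
by rewrite /inbox /= Xa1.
Qed.

End Slide.

(** * Half turn of the rectangle *)
Section Reversal.

Variables (a b j : nat).

Definition rot (u : nat * nat) : nat * nat := (a.-1 - u.1, b.-1 - u.2).

(** Complementing and turning reverses inclusions, so the order of the indices
is reversed to keep the family decreasing. *)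
Definition co_shapes (al : shapes) : shapes := fun i u => ~~ al (j - i) (rot u).

Lemma rot_inbox u : inbox a b u -> inbox a b (rot u).
Proof. by rewrite /inbox /rot /=; lia. Qed.

Lemma rotK u : inbox a b u -> rot (rot u) = u.
Proof. by case: u => x y; rewrite /inbox /rot /= => h; congr pair; lia. Qed.

Lemma rot_cov u v : inbox a b v -> cov u v -> cov (rot v) (rot u).
Proof.
case: u v => x y [x' y']; rewrite /inbox /= => bv /covP /= E.
by apply/covP; case: E bv => -[-> ->] bv; [left|right]; rewrite /rot /=;
  congr pair; lia.
Qed.

Lemma cov_inbox u v : cov u v -> inbox a b v -> inbox a b u.
Proof. by rewrite /inbox; case/covP => -> /=; lia. Qed.

Lemma co_layered al : layered a b j al -> layered a b j (co_shapes al).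
Proof.
move=> L; rewrite /co_shapes.
have sb i : i < j -> j - i = (j - i.+1).+1 by move=> ?; lia.
have lt i : i < j -> j - i.+1 < j by move=> ?; lia.
split=> i u.
- move=> v ij uv bv; have bu := rot_inbox (cov_inbox uv bv).
  have uv' := rot_cov bv uv.
  by apply: contra; apply: (layered_ideal L) uv' bu; lia.
- move=> ij /rot_inbox bu; apply: contra; rewrite (sb i) //.
  exact: (layered_mono L (lt _ ij)).
- move=> v ij uv bv; have bu := rot_inbox (cov_inbox uv bv).
  have uv' := rot_cov bv uv.
  by apply: contra; rewrite (sb i) //; exact: (layered_rook L (lt _ ij) uv').
Qed.

(** The local rule is self-dual: the half turn maps the square with corners
al i.+1, al i, nu i.+1, nu i to a square with the smallest and the largest shape
exchanged. *)
Lemma co_strip al nu :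
  strip a b j al nu -> strip a b j (co_shapes nu) (co_shapes al).
Proof.
move=> S.
have sb i : i < j -> j - i = (j - i.+1).+1 by move=> ?; lia.
have lt i : i < j -> j - i.+1 < j by move=> ?; lia.
split; [exact/co_layered/(strip_outer S) | exact/co_layered/(strip_inner S) |..];
  rewrite /co_shapes => i u.
- move=> ij /rot_inbox bu; apply: contra; apply: (strip_sub S) => //; lia.
- move=> v ij uv bv; have bu := rot_inbox (cov_inbox uv bv).
  have uv' := rot_cov bv uv.
  by apply: contra; apply: (strip_rook S) uv' bu; lia.
- move=> ij bu; rewrite (sb i) // negbK => n1 n2 n3.
  have [v vu nv] := strip_down S (lt _ ij) (rot_inbox bu) n3 n2 n1.
  have bv := cov_inbox vu (rot_inbox bu).
  exists (rot v); rewrite rotK //; split=> //; last exact: rot_inbox.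
  by rewrite -[u]rotK //; apply: rot_cov => //; exact: rot_inbox.
- move=> ij bu; rewrite (sb i) // !negbK => n1 n2 n3.
  have [v [uv bv nv]] := strip_up S (lt _ ij) (rot_inbox bu) n3 n2 n1.
  exists (rot v); rewrite ?rotK //; last by rewrite negbK.
  by rewrite -[u]rotK //; apply: rot_cov.
Qed.

(** The half turn reverses the columns, the rows and the entries at once, so an
increasing subsequence read backwards is increasing again. *)
Lemma co_chain al : chain a b j al -> chain a b j (co_shapes al).
Proof.
case=> r [d C]; exists (fun p => a.-1 - r (b.-1 - p)).
exists (fun p => j.-1 - d (b.-1 - p)) => p pb.
have pb' : b.-1 - p < b by lia.
have [ra dj n1 n2 _] := C _ pb'.
have E : rot (a.-1 - r (b.-1 - p), p) = (r (b.-1 - p), b.-1 - p).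
  by rewrite /rot /=; congr pair; lia.
rewrite /co_shapes E; split=> //; [lia|lia|..].
- by rewrite (_ : j - _ = (d (b.-1 - p)).+1) //; lia.
- by rewrite negbK (_ : j - _ = d (b.-1 - p)) //; lia.
move=> pb1; have qb : b.-1 - p.+1 < b by lia.
have [ra' dj' _ _] := C _ qb.
by rewrite (_ : (b.-1 - p.+1).+1 = b.-1 - p); [case=> //; lia | lia].
Qed.

Lemma chain_co al : chain a b j (co_shapes al) -> chain a b j al.
Proof.
move/co_chain => -[r [d C]]; exists r, d => p pb.
have [ra dj n1 n2 nx] := C _ pb; have bu : inbox a b (r p, p) by rewrite /inbox ra.
move: n1 n2; rewrite /co_shapes rotK // !negbK !subKn //.
exact: ltnW.
Qed.

Lemma chain_strip al nu : strip a b j al nu -> chain a b j al <-> chain a b j nu.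
Proof.
move=> S; split=> [C|]; last exact: chain_slide S.
by apply: chain_co; apply: (chain_slide (co_strip S)); exact: co_chain.
Qed.

End Reversal.

(** * Reflection of corners in growth diagrams *)
Section Corners.

Record growth (a b q : nat) (lam : nat -> shapes) : Prop := Growth {
  growth_strip j m : j <= m -> m < q ->
    strip a b j (lam^~ m) (lam^~ m.+1);
  growth_empty i u : inbox a b u -> ~~ lam i i u;
  growth_full i u : inbox a b u -> lam i (i + q) u }.

(** Both sides say that there is a chain: on the left one at m = j, where the
inner shape is empty and the first row can serve as the chain; on the right one
at m = q, where the outer shape is full and the last row can serve. Chains are
carried from m = j to m = q by chain_strip. *)
Lemma corner_reflection a b q lam : growth a b q lam -> 0 < a -> 0 < b ->
  forall j, j <= q -> lam 0 j (0, b.-1) = ~~ lam j q (a.-1, 0).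
Proof.
move=> G a0 b0 j.
have in_top p : p < b -> inbox a b (0, p) by rewrite /inbox a0.
have in_bot p : p < b -> inbox a b (a.-1, p).
  by move=> pb; rewrite /inbox /= pb andbT; lia.
rewrite leq_eqVlt => /orP[/eqP->|jq].
  by rewrite (growth_full G 0) ?(growth_empty G) //; [apply: in_bot|apply: in_top; lia].
have Lj := strip_inner (growth_strip G (leqnn j) jq).
have Lq : layered a b j (lam^~ q).
  have j1 : j <= q.-1 by lia.
  have q1 : q.-1 < q by lia.
  by have /strip_outer := growth_strip G j1 q1; rewrite (ltn_predK q1).
have slide m : j <= m -> m <= q ->
    chain a b j (lam^~ j) <-> chain a b j (lam^~ m).
  elim: m => [|m IH]; first by rewrite leqn0 => /eqP->.
  rewrite leq_eqVlt => /orP[/eqP-> //|]; rewrite ltnS => jm mq.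
  rewrite IH //; last exact: ltnW.
  exact: chain_strip (growth_strip G jm mq).
have {slide} CC := slide q (ltnW jq) (leqnn q).
apply/idP/idP => [top|bot].
  apply: (chain_start Lq b0); apply/CC; apply: (row_chain Lj b0 a0 top).
  exact/(growth_empty G)/in_top.
apply: (chain_end Lj b0); apply/CC; apply: (row_chain Lq (r := a.-1)) => //.
  lia.
by apply: (growth_full G 0); apply: in_bot; lia.
Qed.

Definition transpose (u : nat * nat) : nat * nat := (u.2, u.1).

Lemma transpose_cov u v : cov (transpose u) (transpose v) = cov u v.
Proof.
case: u v => x y [x' y'].
by rewrite /cov /transpose !xpair_eqE orbC /= andbC [in X in _ || X]andbC.
Qed.

Lemma transpose_inbox a b u : inbox b a (transpose u) = inbox a b u.
Proof. exact: andbC. Qed.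

Lemma growth_transpose a b q lam :
  growth a b q lam -> growth b a q (fun i m u => lam i m (transpose u)).
Proof.
case=> G E F; split.
- have tL j al : layered a b j al -> layered b a j (fun i u => al i (transpose u)).
    case=> L1 L2 L3; split=> i u.
    + by move=> v; rewrite -transpose_cov -transpose_inbox; exact: L1.
    + by rewrite -transpose_inbox; exact: L2.
    + by move=> v; rewrite -transpose_cov -transpose_inbox; exact: L3.
  have tK : involutive transpose by case.
  move=> j m jm mq; have [Li Lo S R U D] := G j m jm mq.
  split; [exact: tL Li | exact: tL Lo |..] => i u.
  + by rewrite -transpose_inbox; exact: S.
  + by move=> v; rewrite -transpose_cov -transpose_inbox; exact: R.
  + rewrite -transpose_inbox => ij bu n1 n2 n3.
    have [v [uv bv nv]] := U _ _ ij bu n1 n2 n3.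
    exists (transpose v); rewrite tK; split=> //.
    * by rewrite -transpose_cov tK.
    * by rewrite transpose_inbox.
  + rewrite -transpose_inbox => ij bu n1 n2 n3.
    have [v uv nv] := D _ _ ij bu n1 n2 n3.
    by exists (transpose v); rewrite ?tK // -transpose_cov tK.
- by move=> i u; rewrite -transpose_inbox; exact: E.
- by move=> i u; rewrite -transpose_inbox; exact: F.
Qed.

End Corners.

(** * Rowmotion in terms of column heights *)
Section Stacks.

Variables (a b c : nat).
Implicit Types (I : ideals (box a b c)) (e f : box a b c) (u v : nat * nat).

(** The column of I over u has height at least k. Asking for the whole brick
below makes this monotone in u and k by definition; for an ideal it is the
same as containing the top box of the column (stack_cell). *)
Definition stack I u k : bool :=
  [&& inbox a b u, k <= c & [forall e : box a b c,
    [&& e.1.1 <= u.1, e.1.2 <= u.2 & e.2 < k] ==> (e \in val I)]].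

Lemma stackP I u k : inbox a b u -> k <= c ->
  reflect (forall e, e.1.1 <= u.1 -> e.1.2 <= u.2 -> e.2 < k -> e \in val I)
          (stack I u k).
Proof.
move=> bu kc; rewrite /stack bu kc /=; apply: (iffP forallP) => H e.
  by move=> h1 h2 h3; have := H e; rewrite h1 h2 h3.
by apply/implyP => /and3P[]; exact: H.
Qed.

Lemma stack_le I u v k l : inbox a b u -> u.1 <= v.1 -> u.2 <= v.2 -> k <= l ->
  stack I v l -> stack I u k.
Proof.
move=> bu h1 h2 kl /and3P[bv lc /forallP H].
apply/stackP => // [|e e1 e2 e3]; first exact: leq_trans lc.
by move/implyP: (H e); apply; lia.
Qed.

Lemma stack0 I u : inbox a b u -> stack I u 0.
Proof. by move=> bu; apply/stackP. Qed.

Lemma stack_over I u k : c < k -> ~~ stack I u k.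
Proof. by move=> ck; rewrite /stack leqNgt ck andbF. Qed.

Lemma ideal_le I e f : (e <= f)%O -> f \in val I -> e \in val I.
Proof.
by move=> ef fI; have /forallP/(_ e)/forallP/(_ f) := valP I; rewrite ef fI.
Qed.

Lemma stack_cell I e : stack I (e.1.1 : nat, e.1.2 : nat) e.2.+1 = (e \in val I).
Proof.
have be : inbox a b (e.1.1 : nat, e.1.2 : nat) by rewrite /inbox !ltn_ord.
apply/(stackP _ be (ltn_ord _))/idP => [H|eI f h1 h2 h3]; first exact: H.
by apply: ideal_le eI; rewrite le_box; apply/and3P.
Qed.

Lemma stackS I u k : stack I u k.+1 ->
  exists e, [/\ e.1.1 = u.1 :> nat, e.1.2 = u.2 :> nat & e.2 = k :> nat].
Proof.
case/and3P=> /andP[ua ub] kc _.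
by exists (Ordinal ua, Ordinal ub, Ordinal kc).
Qed.

Lemma cell u k : inbox a b u -> k < c ->
  exists e, [/\ e.1.1 = u.1 :> nat, e.1.2 = u.2 :> nat & e.2 = k :> nat].
Proof.
by case/andP=> ua ub kc; exists (Ordinal ua, Ordinal ub, Ordinal kc).
Qed.

(** A box of Row I lies weakly below a minimal element of the complement of I, so
everything strictly below that box is in I. *)
Lemma Row_lt I e f : f \in val (Row I) -> (e < f)%O -> e \in val I.
Proof.
rewrite inE => /existsP[m /andP[/andP[_ /forallP/(_ e) mn] fm]] ef.
have em := Order.POrderTheory.lt_le_trans ef fm.
by apply: contraTT em => eI; move/implyP: mn; apply; rewrite inE.
Qed.

Lemma box_lt e f : (e <= f)%O ->
  [|| e.1.1 < f.1.1, e.1.2 < f.1.2 | e.2 < f.2] -> (e < f)%O.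
Proof.
move=> ef h; rewrite Order.POrderTheory.lt_neqAle ef andbT.
by apply: contraTneq h => ->; rewrite !ltnn.
Qed.

Lemma Row_stack_down I u k : stack (Row I) u k.+1 -> stack I u k.
Proof.
move=> H; have [e [e1 e2 e3]] := stackS H.
have /and3P[bu kc _] := H.
have eR : e \in val (Row I) by rewrite -stack_cell e1 e2 e3 -surjective_pairing.
apply/stackP => // [|f f1 f2 f3]; first exact: ltnW.
apply: Row_lt eR _; apply: box_lt; first by rewrite le_box e1 e2 e3; lia.
by rewrite e3 f3 !orbT.
Qed.

Lemma Row_stack_cov I u v k : cov u v -> stack (Row I) v k -> stack I u k.
Proof.
move=> uv H; have /and3P[bv kc _] := H; have bu := cov_inbox uv bv.
case: k H kc => [|k] H kc; first by rewrite stack0.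
have [e [e1 e2 e3]] := stackS H.
have eR : e \in val (Row I) by rewrite -stack_cell e1 e2 e3 -surjective_pairing.
apply/stackP => // f f1 f2 f3; apply: Row_lt eR _.
have {uv} : [&& u.1 <= v.1, u.2 <= v.2 & (u.1 < v.1) || (u.2 < v.2)].
  by case/covP: uv => ->; rewrite /= ltnSn; lia.
case/and3P => uv1 uv2 uv3; apply: box_lt.
  by rewrite le_box e1 e2 e3; lia.
by rewrite e1 e2 e3; lia.
Qed.

(** The next box of a column is added unless a box that it covers is missing,
for otherwise it is minimal in the complement. *)
Lemma Row_blocked_below I u k : k < c -> stack I u k -> ~~ stack I u k.+1 ->
    ~~ stack (Row I) u k.+1 ->
  exists2 v, cov v u & ~~ stack I v k.+1.
Proof.
move=> kc Hk nI nR; have /and3P[bu _ _] := Hk.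
have [e [e1 e2 e3]] := cell bu kc.
have E J : stack J u k.+1 = (e \in val J).
  by rewrite -stack_cell e1 e2 e3 -surjective_pairing.
rewrite E in nI; rewrite {}E in nR.
have : ~~ minimal (~: val I) e.
  apply: contra nR => me; rewrite inE; apply/existsP; exists e.
  by rewrite me Order.POrderTheory.lexx.
rewrite /minimal inE nI /= negb_forall => /existsP[f].
rewrite negb_imply negbK inE => /andP[nf fe].
have fle := Order.POrderTheory.ltW fe; move: fle; rewrite le_box e1 e2 e3.
case/and3P=> f1 f2 f3.
have f3k : f.2 = k :> nat.
  apply/eqP; rewrite eqn_leq f3 leqNgt; apply: contra nf => f3k.
  by move/(stackP _ bu (ltnW kc)): Hk; apply.
have B v : f.1.1 <= v.1 -> f.1.2 <= v.2 -> inbox a b v -> ~~ stack I v k.+1.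
  move=> h1 h2 bv; apply: contra nf => /(stackP _ bv kc); apply=> //.
have [f1u|] := ltnP f.1.1 u.1.
  exists (u.1.-1, u.2).
    by apply/covP; left; rewrite /= (ltn_predK f1u) -surjective_pairing.
  apply: B => //=; first by rewrite -ltnS (ltn_predK f1u).
  by case/andP: bu => ua ub; rewrite /inbox /= ub andbT (leq_ltn_trans (leq_pred _)).
have [f2u|] := ltnP f.1.2 u.2.
  exists (u.1, u.2.-1).
    by apply/covP; right; rewrite /= (ltn_predK f2u) -surjective_pairing.
  apply: B => //=; first by rewrite -ltnS (ltn_predK f2u).
  by case/andP: bu => ua ub; rewrite /inbox /= ua (leq_ltn_trans (leq_pred _)).
move=> g2 g1; case/eqP: (Order.POrderTheory.lt_eqF fe).
case: e e1 e2 e3 f f1 f2 f3 f3k g1 g2 {fe nf nI nR B}.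
case=> ? ? ? /= ? ? ? [[? ?] ?] /= *.
by congr (_, _, _); apply: val_inj => /=; lia.
Qed.

(** A box of I that survives lies strictly below some minimal element of the
complement, so one of the boxes covering it is in Row I. *)
Lemma Row_blocked_above I u k : stack I u k.+1 -> stack (Row I) u k.+1 ->
  stack (Row I) u k.+2 \/ exists2 v, cov u v & stack (Row I) v k.+1.
Proof.
move=> HI HR; have [e [e1 e2 e3]] := stackS HI.
have E J : stack J u k.+1 = (e \in val J).
  by rewrite -stack_cell e1 e2 e3 -surjective_pairing.
have /and3P[bu _ _] := HI.
rewrite E in HI; rewrite {}E in HR.
move: HR; rewrite inE => /existsP[m /andP[mm em]].
have mR : m \in val (Row I).
  by rewrite inE; apply/existsP; exists m; rewrite mm Order.POrderTheory.lexx.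
have nm : m \notin val I by case/andP: mm; rewrite inE.
have := em; rewrite le_box e1 e2 e3 => /and3P[m1 m2 m3].
move: mR; rewrite -stack_cell => mR.
have [m3k|m3k] := ltnP k m.2; first by left; apply: stack_le mR.
right; have {m3k} m3k : m.2 = k :> nat by apply/eqP; rewrite eqn_leq m3k.
have bm : inbox a b (m.1.1 : nat, m.1.2 : nat) by rewrite /inbox !ltn_ord.
rewrite m3k in mR.
have [m1u|g1] := ltnP u.1 m.1.1.
  exists (u.1.+1, u.2); first by apply/covP; left.
  apply: stack_le mR => //; case/andP: bm => ma mb.
  by rewrite /inbox /= (leq_ltn_trans m1u ma) (leq_ltn_trans m2 mb).
have [m2u|g2] := ltnP u.2 m.1.2.
  exists (u.1, u.2.+1); first by apply/covP; right.
  apply: stack_le mR => //; case/andP: bm => ma mb.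
  by rewrite /inbox /= (leq_ltn_trans m1 ma) (leq_ltn_trans m2u mb).
case/negP: nm; rewrite (_ : m = e) //.
case: e e1 e2 e3 m m1 m2 m3 m3k g1 g2 {HI em mm mR bm}.
case=> ? ? ? /= ? ? ? [[? ?] ?] /= *.
by congr (_, _, _); apply: val_inj => /=; lia.
Qed.

End Stacks.

(** * The growth diagram of a rowmotion orbit *)
Section Orbit.

Variables (a b c : nat).
Hypotheses (a0 : 0 < a) (b0 : 0 < b) (c0 : 0 < c).
Implicit Types (I J : ideals (box a b c)) (u v : nat * nat).

Let q := a + b + c - 1.

Definition rank u := u.1 + u.2.

Lemma cov_rank u v : cov u v -> rank v = (rank u).+1.
Proof. by rewrite /rank; case/covP=> ->; rewrite /= ?addnS ?addSn. Qed.

(** The shape lambda_(i,m). The delay by the rank makes left and upper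
neighbours of u at time i + rank u be seen at index i.+1, and neighbours to the
right and below be seen at the previous index, which is the update order of
K-promotion. Truncated subtraction is harmless, since a column has height at
least 0. *)
Definition slice I (i m : nat) u : bool :=
  stack (iter (i + rank u) Row I) u ((rank u + c).+1 - (m - i)).

Lemma Row_stack_pred I u k : inbox a b u -> stack (Row I) u k -> stack I u k.-1.
Proof. by case: k => [|k] bu H /=; [exact: stack0 | exact: Row_stack_down H]. Qed.

Lemma cov_le u v : cov u v -> u.1 <= v.1 /\ u.2 <= v.2.
Proof. by case/covP=> ->; rewrite /= leqnSn leqnn. Qed.

Lemma slice_layered I j m : j <= m -> layered a b j (fun i => slice I i m).
Proof.
move=> jm; rewrite /slice; split=> i u.
- move=> v ij uv bv; rewrite (cov_rank uv) addnS iterS => /(Row_stack_cov uv) H.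
  by apply: stack_le H => //; [exact: cov_inbox uv bv | lia].
- move=> ij bu; rewrite addSn iterS => /(Row_stack_pred bu) H.
  by apply: stack_le H => //; lia.
- move=> v ij uv bv; rewrite (cov_rank uv) addnS addSn.
  have [uv1 uv2] := cov_le uv => H.
  by apply: stack_le H => //; [exact: cov_inbox uv bv | lia].
Qed.

Lemma slice_strip I j m : j <= m -> m < q ->
  strip a b j (fun i => slice I i m) (fun i => slice I i m.+1).
Proof.
move=> jm mq; split; [exact: slice_layered | by apply: slice_layered; exact: leqW |..];
  rewrite /slice => i u.
- by move=> ij bu H; apply: stack_le H => //; lia.
- move=> v ij uv bv; rewrite (cov_rank uv) addnS iterS => /(Row_stack_cov uv) H.
  by apply: stack_le H => //; [exact: cov_inbox uv bv | lia].
- move=> ij bu; rewrite addSn iterS.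
  have [K0|] := posnP ((rank u + c).+1 - (m - i)).
    (* Here al i and nu i.+1 ask for height 0 but al i.+1 for height 1, so that
       m - i = rank u + c + 1. As m < q, there is a right or lower neighbour, and
       nu i asks for height 0 over it. *)
    move=> _ _; have [K2|K2] := posnP ((rank u + c).+1 - (m - i.+1)).
      by rewrite K2 stack0.
    move=> _; have : (u.1.+1 < a) || (u.2.+1 < b).
      by move: K0 K2 mq; rewrite /q /rank; lia.
    have over v : cov u v -> inbox a b v ->
        stack (iter (i + rank v) Row I) v ((rank v + c).+1 - (m.+1 - i)).
      move=> uv bv; rewrite (cov_rank uv).
      by rewrite (_ : _ - _ = 0) ?stack0 //; lia.
    case/andP: bu => ua ub; case/orP=> lt; [exists (u.1.+1, u.2)|exists (u.1, u.2.+1)].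
      have uv : cov u (u.1.+1, u.2) by apply/covP; left.
      have bv : inbox a b (u.1.+1, u.2) by rewrite /inbox lt.
      by split=> //; exact: over.
    have uv : cov u (u.1, u.2.+1) by apply/covP; right.
    have bv : inbox a b (u.1, u.2.+1) by rewrite /inbox lt andbT.
    by split=> //; exact: over.
  case E: (_ - (m - i)) => [//|k] _ HI HR.
  rewrite (_ : _ - (m - i.+1) = k.+2); last by lia.
  have [->//|[v uv Hv] _] := Row_blocked_above HI HR.
  exists v; have /and3P[bv _ _] := Hv; split=> //.
  rewrite (cov_rank uv) addnS iterS.
  by rewrite (_ : _ - _ = k.+1) //; lia.
- move=> ij bu; rewrite addSn iterS subSS.
  case E: (_ - (m - i)) => [|k]; first by rewrite stack0.
  rewrite (_ : _ - (m.+1 - i) = k); last by lia.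
  move=> Hk nI nR; have /and3P[_ kc _] := Hk.
  (* When the column already has height c, the left or the upper neighbour is
     asked to have height c.+1. *)
  move: kc; rewrite leq_eqVlt => /orP[/eqP kc|kc]; last first.
    have [v vu nv] := Row_blocked_below kc Hk nI nR; exists v => //.
    have ruv := cov_rank vu; rewrite addSnnS -ruv.
    by rewrite (_ : _ - _ = k.+1) //; lia.
  have over v : cov v u ->
      ~~ stack (iter (i.+1 + rank v) Row I) v ((rank v + c).+1 - (m - i.+1)).
    by move/cov_rank => uv; apply: stack_over; lia.
  have : (0 < u.1) || (0 < u.2) by move: E; rewrite /rank; lia.
  case/orP=> lt; [exists (u.1.-1, u.2)|exists (u.1, u.2.-1)] => //.
  + by apply/covP; left; rewrite /= (ltn_predK lt) -surjective_pairing.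
  + apply: over; apply/covP; left.
    by rewrite /= (ltn_predK lt) -surjective_pairing.
  + by apply/covP; right; rewrite /= (ltn_predK lt) -surjective_pairing.
  + apply: over; apply/covP; right.
    by rewrite /= (ltn_predK lt) -surjective_pairing.
Qed.

Lemma slice_growth I : growth a b q (slice I).
Proof.
split=> [j m jm mq|i u bu|i u bu]; first exact: slice_strip.
  by apply: stack_over; lia.
rewrite /slice (_ : _ - _ = 0) ?stack0 //.
by move: bu; rewrite /inbox /rank /q; lia.
Qed.

Lemma slice_shift I j m u : slice I j m u = slice (iter j Row I) 0 (m - j) u.
Proof. by rewrite /slice subn0 add0n addnC iterD. Qed.

Lemma iter_Row_surj n J : exists I, iter n Row I = J.
Proof.
have [g _ gK] := @Row_bij _ (box a b c).
elim: n J => [|n IH] J; first by exists J.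
by have [I E] := IH (g J); exists I; rewrite iterS E gK.
Qed.

(** Reflect the corner (0, b-1) to (a-1, 0), then back by the transposed
reflection based at time j. *)
Lemma corner_slice_periodic I j : j <= q ->
  slice I 0 j (0, b.-1) = slice (iter q Row I) 0 j (0, b.-1).
Proof.
move=> jq; rewrite (corner_reflection (slice_growth I)) //.
have GT := growth_transpose (slice_growth (iter j Row I)).
have := corner_reflection GT b0 a0 (leq_subr j q).
rewrite [in X in _ = X -> _]slice_shift -iterD subnK // subKn // /transpose /=.
by rewrite (slice_shift I j q) => ->; rewrite negbK.
Qed.

Lemma corner_periodic I k :
  stack (iter q Row I) (0, b.-1) k = stack I (0, b.-1) k.
Proof.
have [kc|ck] := leqP k c; last by rewrite !(negPf (stack_over _ _ ck)).
have [J <-] := iter_Row_surj b.-1 I.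
(* The corner has rank b - 1, so height k is the slice with m - i = b + c - k. *)
have jq : b + c - k <= q by rewrite /q; lia.
have := corner_slice_periodic J jq; rewrite /slice /rank /= !add0n subn0.
rewrite (_ : _ - _ = k); last by lia.
by rewrite -iterD addnC iterD => ->.
Qed.

(** A constant corner of height c would propagate down the last column of the
rectangle as a full column, one of smaller height along the first row to the left
as a constant height; both are absurd at the far end. *)
Lemma corner_not_constant I :
  ~ (forall n k, stack (iter n Row I) (0, b.-1) k = stack I (0, b.-1) k).
Proof.
move=> H; have bcorner : inbox a b (0, b.-1) by rewrite /inbox a0 /=; lia.
have [full|nfull] := boolP (stack I (0, b.-1) c).
  have down x n : stack (iter (n + x) Row I) (x, b.-1) c.
    elim: x n => [|x IH] n; first by rewrite H.
    have := IH n.+1; have := IH n; rewrite addSn iterS addnS iterS.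
    move=> H1 H2; have := @Row_blocked_above _ _ _ (iter (n + x) Row I) (x, b.-1) c.-1.
    rewrite prednK // => /(_ H1 H2)[|[v /covP[]->]] //.
      by rewrite (negPf (stack_over _ _ (ltnSn c))).
    by case/and3P; rewrite /inbox /= prednK // ltnn andbF.
  by have /and3P[] := down a 0; rewrite /inbox /= ltnn.
have ex : exists k, ~~ stack I (0, b.-1) k by exists c.
case: (ex_minnP ex) => -[|k] nk kmin; first by rewrite stack0 in nk.
have kc : k < c by apply: kmin.
have Hk : stack I (0, b.-1) k by apply/negPn/negP => /kmin; rewrite ltnn.
have left t n : t < b -> ~~ stack (iter n Row I) (0, b.-1 - t) k.+1.
  elim: t n => [|t IH] n tb; first by rewrite subn0 H.
  have tb' := ltnW tb.
  have low : stack (iter n Row I) (0, b.-1 - t) k.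
    apply: (@stack_le _ _ _ _ _ (0, b.-1) _ k) => //=; last by rewrite H.
      by rewrite /inbox a0 /=; lia.
    exact: leq_subr.
  have [v vu nv] := Row_blocked_below kc low (IH n tb') (IH n.+1 tb').
  move: vu nv; rewrite (_ : b.-1 - t = (b.-1 - t.+1).+1); last by lia.
  by case: v => x y /covP[] [] // <- <-.
have tb : b.-1 < b by lia.
have low : stack I (0, b.-1 - b.-1) k.
  apply: (@stack_le _ _ _ _ _ (0, b.-1) _ k) => //=; rewrite ?leq_subr //.
  by rewrite /inbox a0 subnn.
have [v vu _] := Row_blocked_below kc low (left _ 0 tb) (left _ 1 tb).
by move: vu; rewrite subnn => /covP[].
Qed.

(** The corner has period q, and period N because I does; if q and N were coprime,
it would have period 1. *)
Lemma order_not_coprime I : ~~ coprime q (fingraph.order Row I).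
Proof.
set N := fingraph.order Row I.
have N0 : 0 < N by exact: fingraph.order_gt0.
have q0 : 0 < q by rewrite /q; lia.
apply/negP => cop; apply: (@corner_not_constant I) => n k.
have perq m J : stack (iter (m * q) Row J) (0, b.-1) k = stack J (0, b.-1) k.
  elim: m J => [|m IH] J //; by rewrite mulSn iterD corner_periodic IH.
have perN m : iter (m * N) Row I = I.
  elim: m => [|m IH] //; rewrite mulSn iterD IH.
  exact: fingraph.iter_order Row_inj I.
have [u v E _] := egcdnP N q0.
rewrite (eqP cop) in E.
elim: n => [|n IH] //; rewrite -{}IH.
by rewrite -[RHS](perq u) -iterD E addn1 addSnnS addnC iterD perN.
Qed.

End Orbit.

Theorem theorem4p12 (a b c : nat)
    (ha : (1 <= a)%N) (hb : (1 <= b)%N) (hc : (1 <= c)%N)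
    (hprime : prime (a + b + c - 1))
    (hbound : ((2 * a%:R * b%:R - 2) / 3 - a%:R - b%:R + 2 < c%:R :> rat)%R) :
  forall I : ideals (box a b c), a + b + c - 1 %| fingraph.order Row I.
Proof.
move=> I; have := order_not_coprime ha hb hc I.
by rewrite prime_coprime // negbK.
Qed.
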